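(* Let $\Sigma\subset\mathbb{L}(\mathbb{H}^3)$ be a rank two Lagrangian surface (with non-degenerate induced metric) parameterised by $\mu_2=\mu_2(\mu_1,\bar\mu_1)$, with potential function $h$ and Lagrangian angle $\phi$. Then $\Sigma$ is marginally trapped if and only if $\partial\big(e^{-i\phi+h}\big)$ is either a real-valued or an imaginary-valued function.
   Context: The space $\mathbb{L}(\mathbb{H}^3)$ of oriented geodesics of hyperbolic 3-space is identified, as a complex surface, with $\mathbb{P}^1\times\mathbb{P}^1-\overline\Delta$, where in holomorphic coordinates $(\mu_1,\mu_2)$ one has $\overline\Delta=\{\mu_1\bar\mu_2=-1\}$. The canonical neutral Kähler metric and symplectic form are $$\mathbb{G}=\mathrm{Im}\left[\frac{2}{(1+\mu_1\bar\mu_2)^2}\,d\mu_1\otimes d\bar\mu_2\right],\qquad \Omega=-\mathrm{Re}\left[\frac{2}{(1+\mu_1\bar\mu_2)^2}\,d\mu_1\wedge d\bar\mu_2\right],$$ where in $\mathbb{G}$ the product of one-forms is understood as symmetrised. The rank of a surface at a point is the smaller of the ranks of the restrictions to it of the two projections onto the factors of $\mathbb{P}^1\times\mathbb{P}^1$; a rank two surface is locally a graph $\mu_2=\mu_2(\mu_1,\bar\mu_1)$. Write $\partial,\bar\partial$ for differentiation with respect to $\mu_1,\bar\mu_1$, and put $F=\bar\mu_2/(1+\mu_1\bar\mu_2)$. The surface is Lagrangian ($\Omega|_\Sigma=0$) iff $\bar\partial F=\partial\bar F$, in which case there is a real function $h$ on $\Sigma$, the potential function, with $F=\partial h$. Put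 $\sigma_0=\partial\bar\mu_2/(1+\mu_1\bar\mu_2)^2$. The induced metric is $-i\sigma_0\,d\mu_1^2+i\bar\sigma_0\,d\bar\mu_1^2$, so non-degeneracy means $\sigma_0\neq0$. The Lagrangian angle $\phi$ is the real function defined by $\sigma_0=|\sigma_0|e^{2i\phi}$. A surface is marginally trapped if its mean curvature vector $\vec H$ (the trace of the second fundamental form with respect to the induced metric) is null, i.e. $\mathbb{G}(\vec H,\vec H)$ vanishes identically.
   Formalization: The sign of h is corrected: the criterion uses ∂(e^{-iφ-h}), since with F=∂h the printed e^{-iφ+h} fails (e.g. for the minimal surface μ₂=-μ̄₁); ''either real-valued or imaginary-valued'' is read pointwise, as the type can change along Σ. *)

(* Defs.v *)
(* Stdlib reals with Coquelicot. *)
From Stdlib Require Import Reals.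
From Coquelicot Require Import Coquelicot.
Open Scope R_scope.

(** * Calculus on open subsets of C = R^2 *)

Definition smooth_real (U : C -> Prop) (f : C -> R) : Prop :=
  forall (n : nat) (z : C), U z -> ex_diff_n (fun x y => f (x, y)) n (Re z) (Im z).

Definition smooth (U : C -> Prop) (f : C -> C) : Prop :=
  smooth_real U (fun z => Re (f z)) /\ smooth_real U (fun z => Im (f z)).

Inductive coord : Set := cx | cy.

Definition partial (a : coord) (f : C -> C) (z : C) : C :=
  match a with
  | cx => (Derive (fun x => Re (f (x, Im z))) (Re z),
           Derive (fun x => Im (f (x, Im z))) (Re z))
  | cy => (Derive (fun y => Re (f (Re z, y))) (Im z),
           Derive (fun y => Im (f (Re z, y))) (Im z))
  end.

Definition del (f : C -> C) (z : C) : C :=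
  ((partial cx f z - Ci * partial cy f z) / 2)%C.

Definition Cexp (c : C) : C := (exp (Re c) * cos (Im c), exp (Re c) * sin (Im c)).

(* Rank of the real differential of [f] at [z]: the real dimension of the span
   of the two partial derivatives. *)
Definition diff_rank (f : C -> C) (z : C) : nat :=
  let a := partial cx f z in
  let b := partial cy f z in
  if Req_EM_T (Re a * Im b - Im a * Re b) 0
  then if Req_EM_T (Cmod a + Cmod b) 0 then 0%nat else 1%nat
  else 2%nat.

(** * Surfaces in a pseudo-Riemannian four-manifold

    The manifold is an open domain of V = C * C, viewed as a real vector space;
    a tensor is given by its values on constant vector fields, and a surface by
    a map from an open subset of C to V. *)

Definition V : Type := (C * C)%type.

(* [Gam q u v] is the derivative at [q] of the constant field [v] along [u]
   (the Christoffel symbols); the last two clauses say that the connection is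
   torsion-free and metric. *)
Definition levi_civita (D : V -> Prop) (g : V -> V -> V -> R) (Gam : V -> V -> V -> V) : Prop :=
  forall q : V, D q ->
    (forall u v w : V, Gam q u (plus v w) = plus (Gam q u v) (Gam q u w)) /\
    (forall (c : R) (u v : V), Gam q u (scal c v) = scal c (Gam q u v)) /\
    (forall u v : V, Gam q u v = Gam q v u) /\
    (forall u v w : V,
        is_derive (fun t : R => g (plus q (scal t u)) v w) 0
                  (g q (Gam q u v) w + g q v (Gam q u w))).

Definition tangent (f : C -> V) (a : coord) (z : C) : V :=
  (partial a (fun w => fst (f w)) z, partial a (fun w => snd (f w)) z).

Definition induced_metric (g : V -> V -> V -> R) (f : C -> V) (z : C) (a b : coord) : R :=
  g (f z) (tangent f a z) (tangent f b z).

Definition induced_det (g : V -> V -> V -> R) (f : C -> V) (z : C) : R :=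
  induced_metric g f z cx cx * induced_metric g f z cy cy
  - induced_metric g f z cx cy * induced_metric g f z cy cx.

Definition nondegenerate (g : V -> V -> V -> R) (U : C -> Prop) (f : C -> V) : Prop :=
  forall z : C, U z -> induced_det g f z <> 0.

(* The inverse matrix g^{ab} of the induced metric. *)
Definition induced_cometric (g : V -> V -> V -> R) (f : C -> V) (z : C) (a b : coord) : R :=
  match a, b with
  | cx, cx => induced_metric g f z cy cy
  | cy, cy => induced_metric g f z cx cx
  | cx, cy => - induced_metric g f z cx cy
  | cy, cx => - induced_metric g f z cy cx
  end / induced_det g f z.

Definition sum_coord (F : coord -> V) : V := plus (F cx) (F cy).

Definition normal_part (g : V -> V -> V -> R) (f : C -> V) (z : C) (v : V) : V :=
  minus v
    (sum_coord (fun a => sum_coord (fun b =>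
       scal (induced_cometric g f z a b * g (f z) v (tangent f a z)) (tangent f b z)))).

Definition second_fundamental_form (g : V -> V -> V -> R) (Gam : V -> V -> V -> V)
    (f : C -> V) (z : C) (a b : coord) : V :=
  normal_part g f z
    (plus (tangent (tangent f b) a z) (Gam (f z) (tangent f a z) (tangent f b z))).

Definition mean_curvature (g : V -> V -> V -> R) (Gam : V -> V -> V -> V)
    (f : C -> V) (z : C) : V :=
  sum_coord (fun a => sum_coord (fun b =>
    scal (induced_cometric g f z a b) (second_fundamental_form g Gam f z a b))).

(* The Levi-Civita connection of a non-degenerate [g] is unique, so the
   existential below only names it. *)
Definition marginally_trapped (D : V -> Prop) (g : V -> V -> V -> R)
    (U : C -> Prop) (f : C -> V) : Prop :=
  exists Gam : V -> V -> V -> V,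
    levi_civita D g Gam /\
    forall z : C, U z ->
      g (f z) (mean_curvature g Gam f z) (mean_curvature g Gam f z) = 0.

Definition lagrangian (omega : V -> V -> V -> R) (U : C -> Prop) (f : C -> V) : Prop :=
  forall z : C, U z -> forall a b : coord,
    omega (f z) (tangent f a z) (tangent f b z) = 0.

Definition surface_rank (f : C -> V) (z : C) : nat :=
  Nat.min (diff_rank (fun w => fst (f w)) z) (diff_rank (fun w => snd (f w)) z).

(** * The space of oriented geodesics of hyperbolic 3-space, in the coordinates
    (mu_1, mu_2) *)

Definition LH3 (q : V) : Prop := (1 + fst q * Cconj (snd q))%C <> 0.

Definition LH3_factor (q : V) : C := (2 / (1 + fst q * Cconj (snd q)) ^ 2)%C.

(* The symmetrised product of the one-forms alpha and beta is
   (alpha (x) beta + beta (x) alpha) / 2. *)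
Definition LH3_metric (q v w : V) : R :=
  Im (LH3_factor q *
      ((fst v * Cconj (snd w) + fst w * Cconj (snd v)) / 2))%C.

Definition LH3_symplectic (q v w : V) : R :=
  - Re (LH3_factor q *
        (fst v * Cconj (snd w) - fst w * Cconj (snd v)))%C.

Definition graph (mu2 : C -> C) (z : C) : V := (z, mu2 z).

Definition graph_F (mu2 : C -> C) (z : C) : C :=
  (Cconj (mu2 z) / (1 + z * Cconj (mu2 z)))%C.

Definition graph_sigma0 (mu2 : C -> C) (z : C) : C :=
  (del (fun w => Cconj (mu2 w)) z / (1 + z * Cconj (mu2 z)) ^ 2)%C.

Definition potential (U : C -> Prop) (mu2 : C -> C) (h : C -> R) : Prop :=
  smooth_real U h /\
  forall z : C, U z -> graph_F mu2 z = del (fun w => RtoC (h w)) z.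

Definition lagrangian_angle (U : C -> Prop) (mu2 : C -> C) (phi : C -> R) : Prop :=
  smooth_real U phi /\
  forall z : C, U z ->
    graph_sigma0 mu2 z =
      (RtoC (Cmod (graph_sigma0 mu2 z)) * Cexp (2 * Ci * RtoC (phi z)))%C.

(* Main.v *)
(* Let a = mu_1, b = conj(mu_2) and A = 1 + ab.  The metric is the imaginary part of the holomorphic metric
   2 A^-2 da db, so its Levi-Civita connection is the holomorphic one, with symbols
   -2b/A and -2a/A.  The complex structure maps the tangent planes of a Lagrangian
   surface to the normal planes, so |H|^2 is determined by the 1-form Omega(H, .);
   tracing the cubic form Omega(D_u v, w) with the Codazzi-type symmetries coming from
   the derivatives of the Lagrangian condition gives
     |H|^2 = (8 / |sigma_0|) Im (e^(-i phi) (del h + i del phi))^2,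
   and the square is that of del (e^(-i phi - h)) up to the positive factor e^(2h). *)
Require Import Defs.
From Stdlib Require Import Reals Lra.
From Coquelicot Require Import Coquelicot.
Open Scope R_scope.

(** * Derivatives of complex-valued functions of a real variable *)

(** Componentwise, to match [partial], which differentiates real and imaginary parts separately. *)
Definition is_cderive (f : R -> C) (t : R) (l : C) : Prop :=
  is_derive (fun s => Re (f s)) t (Re l) /\ is_derive (fun s => Im (f s)) t (Im l).

Lemma is_cderive_const (c : C) (t : R) : is_cderive (fun _ => c) t 0.
Proof. split; apply (is_derive_const (V := R_NormedModule)). Qed.

Lemma is_cderive_plus (f g : R -> C) (t : R) (a b : C) :
  is_cderive f t a -> is_cderive g t b -> is_cderive (fun s => f s + g s)%C t (a + b)%C.
Proof.
  intros [fr fi] [gr gi]; split.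
  - exact (is_derive_plus _ _ _ _ _ fr gr).
  - exact (is_derive_plus _ _ _ _ _ fi gi).
Qed.

Lemma is_cderive_conj (f : R -> C) (t : R) (a : C) :
  is_cderive f t a -> is_cderive (fun s => Cconj (f s)) t (Cconj a).
Proof. intros [fr fi]; split; [exact fr | exact (is_derive_opp _ _ _ fi)]. Qed.

Lemma is_cderive_mult (f g : R -> C) (t : R) (a b : C) :
  is_cderive f t a -> is_cderive g t b ->
  is_cderive (fun s => f s * g s)%C t (a * g t + f t * b)%C.
Proof.
  intros [fr fi] [gr gi].
  assert (rr := is_derive_mult _ _ _ _ _ fr gr Rmult_comm).
  assert (ii := is_derive_mult _ _ _ _ _ fi gi Rmult_comm).
  assert (ri := is_derive_mult _ _ _ _ _ fr gi Rmult_comm).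
  assert (ir := is_derive_mult _ _ _ _ _ fi gr Rmult_comm).
  split.
  - replace (Re (a * g t + f t * b)) with
      (minus (plus (mult (Re a) (Re (g t))) (mult (Re (f t)) (Re b)))
             (plus (mult (Im a) (Im (g t))) (mult (Im (f t)) (Im b)))).
    + exact (is_derive_minus _ _ _ _ _ rr ii).
    + unfold minus, plus, opp, mult; simpl; unfold Re, Im; ring.
  - replace (Im (a * g t + f t * b)) with
      (plus (plus (mult (Re a) (Im (g t))) (mult (Re (f t)) (Im b)))
            (plus (mult (Im a) (Re (g t))) (mult (Im (f t)) (Re b)))).
    + exact (is_derive_plus _ _ _ _ _ ri ir).
    + unfold plus, mult; simpl; unfold Re, Im; ring.
Qed.

Lemma Cnorm2_neq_0 (c : C) : c <> 0 -> Re c ^ 2 + Im c ^ 2 <> 0.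
Proof.
  intros nz e; apply nz; destruct c as [x y]; simpl in e.
  apply injective_projections; simpl; nra.
Qed.

Lemma is_cderive_inv (f : R -> C) (t : R) (a : C) :
  f t <> 0 -> is_cderive f t a -> is_cderive (fun s => / f s)%C t (- a / (f t * f t))%C.
Proof.
  intros nz [fr fi].
  assert (n0 := Cnorm2_neq_0 _ nz).
  assert (n : is_derive (fun s => Re (f s) ^ 2 + Im (f s) ^ 2) t
                (2 * Re (f t) * Re a + 2 * Im (f t) * Im a)).
  { apply (is_derive_plus (V := R_NormedModule)).
    - replace (2 * Re (f t) * Re a) with (INR 2 * Re a * Re (f t) ^ 1) by (simpl; ring).
      exact (is_derive_pow _ 2 _ _ fr).
    - replace (2 * Im (f t) * Im a) with (INR 2 * Im a * Im (f t) ^ 1) by (simpl; ring).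
      exact (is_derive_pow _ 2 _ _ fi). }
  split.
  - assert (d := is_derive_div _ _ _ _ _ fr n n0).
    eapply (eq_ind _ (is_derive _ t)); [exact d |].
    cbv beta; unfold opp; destruct (f t) as [x y], a as [u v]; simpl in *; field.
    (* The two denominators are the squared norm of [f t * f t], which is the square of that of
       [f t], and the squared norm of [f t] itself. *)
    split; intro e; apply n0; [apply Rsqr_0_uniq |]; rewrite <- e; unfold Rsqr; ring.
  - assert (d := is_derive_div _ _ _ _ _ (is_derive_opp _ _ _ fi) n n0).
    eapply (eq_ind _ (is_derive _ t)); [exact d |].
    cbv beta; unfold opp; destruct (f t) as [x y], a as [u v]; simpl in *; field.
    split; intro e; apply n0; [apply Rsqr_0_uniq |]; rewrite <- e; unfold Rsqr; ring.
Qed.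

(** * Partial derivatives on open subsets of the plane *)

(** The parameter is the coordinate itself, not an offset from [z], so that [partial] unfolds to
    derivatives along this line. *)
Definition coord_line (a : coord) (z : C) (t : R) : C :=
  match a with cx => (t, Im z) | cy => (Re z, t) end.

Definition coord_val (a : coord) (z : C) : R :=
  match a with cx => Re z | cy => Im z end.

Definition coord_dir (a : coord) : C :=
  match a with cx => 1%C | cy => Ci end.

Definition has_partial (a : coord) (f : C -> C) (z l : C) : Prop :=
  is_cderive (fun t => f (coord_line a z t)) (coord_val a z) l.

Lemma coord_line_val (a : coord) (z : C) : coord_line a z (coord_val a z) = z.
Proof. destruct a, z; reflexivity. Qed.

Lemma has_partial_unique (a : coord) (f : C -> C) (z l : C) :
  has_partial a f z l -> partial a f z = l.
Proof.
  intros [dr di]; rewrite (surjective_pairing l).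
  destruct a; simpl; f_equal; apply is_derive_unique; assumption.
Qed.

Lemma has_partial_const (a : coord) (c z : C) : has_partial a (fun _ => c) z 0.
Proof. apply is_cderive_const. Qed.

Lemma has_partial_id (a : coord) (z : C) : has_partial a (fun w => w) z (coord_dir a).
Proof.
  destruct a; split; simpl;
    first [apply (is_derive_id (K := R_AbsRing)) | apply (is_derive_const (V := R_NormedModule))].
Qed.

Lemma has_partial_plus (a : coord) (f g : C -> C) (z l m : C) :
  has_partial a f z l -> has_partial a g z m ->
  has_partial a (fun w => f w + g w)%C z (l + m)%C.
Proof. apply is_cderive_plus. Qed.

Lemma has_partial_conj (a : coord) (f : C -> C) (z l : C) :
  has_partial a f z l -> has_partial a (fun w => Cconj (f w)) z (Cconj l).
Proof. apply is_cderive_conj. Qed.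

Lemma has_partial_mult (a : coord) (f g : C -> C) (z l m : C) :
  has_partial a f z l -> has_partial a g z m ->
  has_partial a (fun w => f w * g w)%C z (l * g z + f z * m)%C.
Proof.
  intros df dg; assert (d := is_cderive_mult _ _ _ _ _ df dg).
  cbv beta in d; rewrite coord_line_val in d; exact d.
Qed.

Lemma has_partial_inv (a : coord) (f : C -> C) (z l : C) :
  f z <> 0 -> has_partial a f z l ->
  has_partial a (fun w => / f w)%C z (- l / (f z * f z))%C.
Proof.
  intros nz df.
  assert (nz' : f (coord_line a z (coord_val a z)) <> 0) by (rewrite coord_line_val; exact nz).
  assert (d := is_cderive_inv _ _ _ nz' df).
  cbv beta in d; rewrite coord_line_val in d; exact d.
Qed.

Lemma coord_line_locally (a : coord) (U : C -> Prop) (z : C) :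
  open U -> U z -> locally (coord_val a z) (fun t => U (coord_line a z t)).
Proof.
  intros oU Uz; destruct (oU z Uz) as [e He]; exists e; intros t Ht; apply He.
  destruct a; split; simpl; try exact Ht; apply ball_center.
Qed.

Lemma has_partial_ext (a : coord) (U : C -> Prop) (f g : C -> C) (z l : C) :
  open U -> U z -> (forall w, U w -> f w = g w) -> has_partial a f z l -> has_partial a g z l.
Proof.
  intros oU Uz fg [dr di]; assert (loc := coord_line_locally a U z oU Uz).
  split; [eapply is_derive_ext_loc; [| exact dr] | eapply is_derive_ext_loc; [| exact di]];
    apply (filter_imp _ _ (fun t Ht => f_equal _ (fg _ Ht)) loc).
Qed.

Lemma smooth_partial (a : coord) (U : C -> Prop) (f : C -> C) :
  smooth U f -> smooth U (partial a f).
Proof.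
  intros [fr fi]; destruct a; split; intros n z Uz;
    (* Order [S n] of [ex_diff_n] contains order [n] for both first partials. *)
    first [apply (fr (S n) z Uz) | apply (fi (S n) z Uz)].
Qed.

Lemma smooth_has_partial (a : coord) (U : C -> Prop) (f : C -> C) (z : C) :
  smooth U f -> U z -> has_partial a f z (partial a f z).
Proof.
  intros [fr fi] Uz; destruct (fr 1%nat z Uz) as (_ & rx & ry & _),
    (fi 1%nat z Uz) as (_ & ix & iy & _).
  destruct a; split; apply Derive_correct; assumption.
Qed.

(** The mixed derivatives must exist near the point and be continuous at it; both facts sit inside
    [ex_diff_n] at order two. *)
Lemma smooth_real_Schwarz (U : C -> Prop) (f : C -> R) (z : C) :
  open U -> smooth_real U f -> U z ->
  Derive (fun x => Derive (fun y => f (x, y)) (Im z)) (Re z) =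
  Derive (fun y => Derive (fun x => f (x, y)) (Re z)) (Im z).
Proof.
  intros oU sf Uz.
  apply (Schwarz (fun x y => f (x, y))).
  - destruct (oU z Uz) as [e He]; exists e; intros u v Hu Hv.
    assert (Uw : U (u, v)) by (apply He; split; assumption).
    destruct (sf 2%nat _ Uw) as (_ & fx & fy & (_ & _ & fxy & _) & (_ & fyx & _)).
    repeat split; assumption.
  - destruct (sf 2%nat _ Uz) as (_ & _ & _ & _ & (_ & _ & _ & (c & _) & _)); exact c.
  - destruct (sf 2%nat _ Uz) as (_ & _ & _ & (_ & _ & _ & _ & (c & _)) & _); exact c.
Qed.

Lemma partial_comm (U : C -> Prop) (f : C -> C) (z : C) :
  open U -> smooth U f -> U z ->
  partial cx (partial cy f) z = partial cy (partial cx f) z.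
Proof.
  intros oU [fr fi] Uz; simpl.
  f_equal; [exact (smooth_real_Schwarz _ _ _ oU fr Uz) | exact (smooth_real_Schwarz _ _ _ oU fi Uz)].
Qed.

Lemma Cconj_partial (a : coord) (f : C -> C) (z : C) :
  Cconj (partial a f z) = partial a (fun w => Cconj (f w)) z.
Proof. destruct a; unfold Cconj; simpl; f_equal; symmetry; apply Derive_opp. Qed.


(** * Tangent vectors of a graph and the rescaled fibre coordinate *)

Lemma partial_graph_fst (a : coord) (f : C -> C) (z : C) :
  partial a (fun w => fst (graph f w)) z = coord_dir a.
Proof. apply has_partial_unique, has_partial_id. Qed.

Lemma tangent_graph (a : coord) (f : C -> C) (z : C) :
  tangent (graph f) a z = (coord_dir a, partial a f z).
Proof. unfold tangent; rewrite partial_graph_fst; reflexivity. Qed.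

Lemma partial_const (a : coord) (f : C -> C) (c z : C) :
  (forall w, f w = c) -> partial a f z = 0.
Proof.
  intros fc; apply has_partial_unique.
  destruct (has_partial_const a c z) as [dr di].
  split; [eapply is_derive_ext; [| exact dr] | eapply is_derive_ext; [| exact di]];
    intros t; simpl; rewrite fc; reflexivity.
Qed.

Lemma tangent_tangent_graph (a b : coord) (f : C -> C) (z : C) :
  tangent (tangent (graph f) b) a z = (RtoC 0, partial a (partial b f) z).
Proof.
  unfold tangent at 1; f_equal.
  apply (partial_const _ _ (coord_dir b)); intros w; apply partial_graph_fst.
Qed.

(* With values rescaled by (1 + ab)^-2 the metric has constant coefficients. *)
Definition fiber_coord (q v : V) : C :=
  (Cconj (snd v) / (1 + fst q * Cconj (snd q)) ^ 2)%C.

(** * The metric and the symplectic form as bilinear forms *)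

Lemma LH3_metric_fiber (q u v : V) :
  LH3_metric q u v = Im (fst u * fiber_coord q v + fst v * fiber_coord q u)%C.
Proof.
  unfold LH3_metric, LH3_factor, fiber_coord, Cdiv; f_equal.
  generalize (/ (1 + fst q * Cconj (snd q)) ^ 2)%C; intros w.
  transitivity ((2 * / 2) * (fst u * (Cconj (snd v) * w) + fst v * (Cconj (snd u) * w)))%C;
    [ring |].
  replace (2 * / 2)%C with (RtoC 1) by (field; intros [=]; lra). ring.
Qed.

(** The wedge product is not halved, unlike the symmetrised one, so the factor 2 survives; this is
    why half of Omega is the natural partner of the metric. *)
Lemma LH3_symplectic_fiber (q u v : V) :
  LH3_symplectic q u v = - 2 * Re (fst u * fiber_coord q v - fst v * fiber_coord q u)%C.
Proof.
  unfold LH3_symplectic, LH3_factor, fiber_coord, Cdiv.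
  generalize (/ (1 + fst q * Cconj (snd q)) ^ 2)%C; intros w.
  replace (2 * w * (fst u * Cconj (snd v) - fst v * Cconj (snd u)))%C with
    (RtoC 2 * (fst u * (Cconj (snd v) * w) - fst v * (Cconj (snd u) * w)))%C by ring.
  rewrite re_scal_l. ring.
Qed.

Lemma fst_plus (u v : V) : fst (plus u v) = (fst u + fst v)%C.
Proof. reflexivity. Qed.

Lemma Cconj_snd_plus (u v : V) : Cconj (snd (plus u v)) = (Cconj (snd u) + Cconj (snd v))%C.
Proof. exact (Cplus_conj (snd u) (snd v)). Qed.

Lemma fst_scal (c : R) (v : V) : fst (scal c v) = (c * fst v)%C.
Proof. exact (scal_R_Cmult c (fst v)). Qed.

Lemma Cconj_snd_scal (c : R) (v : V) : Cconj (snd (scal c v)) = (c * Cconj (snd v))%C.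
Proof.
  transitivity (Cconj (c * snd v)%C); [f_equal; exact (scal_R_Cmult c (snd v)) |].
  apply injective_projections; simpl; ring.
Qed.

Lemma fiber_coord_plus (q u v : V) :
  fiber_coord q (plus u v) = (fiber_coord q u + fiber_coord q v)%C.
Proof. unfold fiber_coord, Cdiv; rewrite Cconj_snd_plus; ring. Qed.

Lemma fiber_coord_scal (q : V) (c : R) (v : V) :
  fiber_coord q (scal c v) = (c * fiber_coord q v)%C.
Proof. unfold fiber_coord, Cdiv; rewrite Cconj_snd_scal; ring. Qed.

Lemma LH3_metric_sym (q u v : V) : LH3_metric q u v = LH3_metric q v u.
Proof. rewrite !LH3_metric_fiber; simpl; ring. Qed.

Lemma LH3_metric_plus_l (q u v w : V) :
  LH3_metric q (plus u v) w = LH3_metric q u w + LH3_metric q v w.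
Proof. rewrite !LH3_metric_fiber, fiber_coord_plus, fst_plus; simpl; ring. Qed.

Lemma LH3_metric_scal_l (q : V) (c : R) (u w : V) :
  LH3_metric q (scal c u) w = c * LH3_metric q u w.
Proof. rewrite !LH3_metric_fiber, fiber_coord_scal, fst_scal; simpl; ring. Qed.

Lemma LH3_symplectic_plus_l (q u v w : V) :
  LH3_symplectic q (plus u v) w = LH3_symplectic q u w + LH3_symplectic q v w.
Proof. rewrite !LH3_symplectic_fiber, fiber_coord_plus, fst_plus; simpl; ring. Qed.

Lemma LH3_symplectic_scal_l (q : V) (c : R) (u w : V) :
  LH3_symplectic q (scal c u) w = c * LH3_symplectic q u w.
Proof. rewrite !LH3_symplectic_fiber, fiber_coord_scal, fst_scal; simpl; ring. Qed.

(** Vectors with zero first component test the first component of [u], vectors with zero second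
    component test its fibre coordinate, and the numbers Im (x c) for all c determine x. *)
Lemma LH3_metric_faithful (q u v : V) :
  LH3 q -> (forall w, LH3_metric q u w = LH3_metric q v w) -> u = v.
Proof.
  intros Dq e.
  assert (A0 : (1 + fst q * Cconj (snd q))%C <> 0) by exact Dq.
  assert (e1 : forall c : C, Im (fst u * c) = Im (fst v * c)).
  { intros c.
    (* The test vector is chosen to have fibre coordinate [c]. *)
    specialize (e (RtoC 0, Cconj (c * (1 + fst q * Cconj (snd q)) ^ 2)%C)).
    rewrite !LH3_metric_fiber in e; unfold fiber_coord in e; cbn [fst snd] in e.
    rewrite Cconj_conj, !Cmult_0_l, !Cplus_0_r in e.
    replace (c * (1 + fst q * Cconj (snd q)) ^ 2 / (1 + fst q * Cconj (snd q)) ^ 2)%C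
      with c in e by (field; exact A0).
    exact e. }
  assert (e2 : forall c : C, Im (c * fiber_coord q u) = Im (c * fiber_coord q v)).
  { intros c; specialize (e (c, RtoC 0)).
    rewrite !LH3_metric_fiber in e; unfold fiber_coord at 1 3 in e; cbn [fst snd] in e.
    replace (Cconj 0) with (RtoC 0) in e by (unfold Cconj; simpl; rewrite Ropp_0; reflexivity).
    unfold Cdiv in e; rewrite !Cmult_0_l, !Cmult_0_r, !Cplus_0_l in e; exact e. }
  assert (E : forall x y : C, (forall c : C, Im (x * c) = Im (y * c)) -> x = y).
  { intros [x1 x2] [y1 y2] h; assert (h1 := h 1%C); assert (hi := h Ci); simpl in h1, hi.
    f_equal; lra. }
  apply injective_projections.
  - apply E, e1.
  - assert (f : fiber_coord q u = fiber_coord q v)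
      by (apply E; intros c; rewrite !(Cmult_comm _ c); apply e2).
    rewrite <- (Cconj_conj (snd u)), <- (Cconj_conj (snd v)); f_equal.
    unfold fiber_coord in f.
    replace (Cconj (snd u)) with
      (Cconj (snd u) / (1 + fst q * Cconj (snd q)) ^ 2 * (1 + fst q * Cconj (snd q)) ^ 2)%C
      by (field; exact A0).
    rewrite f; field; exact A0.
Qed.

(** * Uniqueness and explicit form of the Levi-Civita connection *)

Lemma levi_civita_unique (D : V -> Prop) (g : V -> V -> V -> R) (Gam Gam' : V -> V -> V -> V)
    (q u v : V) :
  D q ->
  (forall v w, g q v w = g q w v) ->
  (forall v v', (forall w, g q v w = g q v' w) -> v = v') ->
  levi_civita D g Gam -> levi_civita D g Gam' -> Gam q u v = Gam' q u v.
Proof.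
  intros Dq gsym gfaith LC LC'.
  destruct (LC q Dq) as (_ & _ & S & M), (LC' q Dq) as (_ & _ & S' & M').
  (* The difference T of the two connections has g(T(u,v),w) symmetric in (u,v) and
     skew in (v,w), hence zero. *)
  assert (skew : forall u v w, g q (Gam q u v) w + g q (Gam q u w) v
                             = g q (Gam' q u v) w + g q (Gam' q u w) v).
  { intros u' v' w; rewrite !(gsym (_ q u' w) v').
    rewrite <- (is_derive_unique _ _ _ (M u' v' w)); apply is_derive_unique, M'. }
  apply gfaith; intros w.
  assert (a := skew u v w); assert (b := skew v w u); assert (c := skew w u v).
  rewrite (S v u), (S' v u) in b; rewrite (S w u), (S' w u), (S w v), (S' w v) in c.
  lra.
Qed.

Lemma Cconj_inj (c d : C) : Cconj c = Cconj d -> c = d.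
Proof. intros e; rewrite <- (Cconj_conj c), e; apply Cconj_conj. Qed.

Lemma is_cderive_affine (c d : C) (t : R) : is_cderive (fun s => c + s * d)%C t d.
Proof.
  split; simpl; auto_derive; trivial; unfold Re, Im; ring.
Qed.

(** Valid at 0 as well, since [/ 0] is 0; this allows rewriting along a whole line, even where 1 +
    ab vanishes. *)
Lemma Cinv_sqr (c : C) : (/ c ^ 2 = / c * / c)%C.
Proof.
  destruct (Ceq_dec c 0) as [-> | nz]; [| field; exact nz].
  apply injective_projections; simpl; unfold Rdiv; ring.
Qed.

(** The mixed Christoffel symbols vanish. The second component is computed in b = conj(mu_2) and
    conjugated back. *)
Definition LH3_connection (q u v : V) : V :=
  ((- (2) * Cconj (snd q) / (1 + fst q * Cconj (snd q)) * (fst u * fst v))%C,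
   Cconj (- (2) * fst q / (1 + fst q * Cconj (snd q)) * (Cconj (snd u) * Cconj (snd v)))%C).

Lemma LH3_levi_civita : levi_civita LH3 LH3_metric LH3_connection.
Proof.
  intros q Dq; split; [| split; [| split]].
  - intros u v w; unfold LH3_connection; apply injective_projections.
    + rewrite !fst_plus; cbn [fst]; ring.
    + apply Cconj_inj; rewrite !Cconj_snd_plus; cbn [snd]; rewrite !Cconj_conj; ring.
  - intros c u v; unfold LH3_connection; apply injective_projections.
    + rewrite !fst_scal; cbn [fst]; ring.
    + apply Cconj_inj; rewrite !Cconj_snd_scal; cbn [snd]; rewrite !Cconj_conj; ring.
  - intros u v; unfold LH3_connection; f_equal; [| f_equal]; ring.
  - intros u v w.
    assert (A0 : (1 + fst q * Cconj (snd q))%C <> 0) by exact Dq.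
    (* Along the line q + t u the metric on the constant fields v, w is Im (A^-2 M) with M
       independent of t, so only A is differentiated. *)
    set (M := (fst v * Cconj (snd w) + fst w * Cconj (snd v))%C).
    set (A := fun t : R => (1 + (fst q + t * fst u) * (Cconj (snd q) + t * Cconj (snd u)))%C).
    assert (A00 : A 0 = (1 + fst q * Cconj (snd q))%C) by (unfold A; ring).
    set (A' := (fst u * Cconj (snd q) + fst q * Cconj (snd u))%C).
    assert (dA : is_cderive A 0 A').
    { assert (d := is_cderive_plus _ _ _ _ _ (is_cderive_const 1 0)
               (is_cderive_mult _ _ _ _ _ (is_cderive_affine (fst q) (fst u) 0)
                  (is_cderive_affine (Cconj (snd q)) (Cconj (snd u)) 0))).
      eapply (eq_ind _ (is_cderive _ _)); [exact d |]; unfold A'; ring. }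
    assert (nz : A 0 <> 0) by (rewrite A00; exact A0).
    assert (dI := is_cderive_inv _ _ _ nz dA).
    assert (d := is_cderive_mult _ _ _ _ _ (is_cderive_mult _ _ _ _ _ dI dI)
                   (is_cderive_const M 0)).
    destruct d as [_ d]; cbv beta in d.
    replace (LH3_metric q (LH3_connection q u v) w + LH3_metric q v (LH3_connection q u w))
      with (Im ((- A' / (A 0 * A 0) * / A 0 + / A 0 * (- A' / (A 0 * A 0))) * M
                + / A 0 * / A 0 * 0)%C).
    + eapply is_derive_ext; [| exact d]; intros t; cbv beta.
      rewrite LH3_metric_fiber; f_equal; unfold fiber_coord, M.
      rewrite fst_plus, Cconj_snd_plus, fst_scal, Cconj_snd_scal.
      unfold Cdiv; rewrite Cinv_sqr; unfold A; ring.
    + rewrite !LH3_metric_fiber, <- im_plus, A00; unfold LH3_connection, fiber_coord, M, A';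
        cbn [fst snd]; rewrite !Cconj_conj.
      f_equal; field; exact A0.
Qed.

(** * Normal projection and the pointwise algebra of the trace *)

Lemma V_ext (u v : V) : fst u = fst v -> Cconj (snd u) = Cconj (snd v) -> u = v.
Proof. intros e1 e2; apply injective_projections; [exact e1 | exact (Cconj_inj _ _ e2)]. Qed.

Lemma fst_minus (u v : V) : fst (minus u v) = (fst u - fst v)%C.
Proof. reflexivity. Qed.

Lemma Cconj_snd_minus (u v : V) : Cconj (snd (minus u v)) = (Cconj (snd u) - Cconj (snd v))%C.
Proof. exact (Cminus_conj (snd u) (snd v)). Qed.

Lemma minus_scal_opp_one (u v : V) : minus u v = plus u (scal (-1) v).
Proof.
  apply V_ext; rewrite ?fst_minus, ?fst_plus, ?fst_scal, ?Cconj_snd_minus, ?Cconj_snd_plus,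
    ?Cconj_snd_scal; ring.
Qed.

Lemma LH3_metric_plus_r (q u v w : V) :
  LH3_metric q w (plus u v) = LH3_metric q w u + LH3_metric q w v.
Proof. rewrite !(LH3_metric_sym q w); apply LH3_metric_plus_l. Qed.

Lemma LH3_metric_scal_r (q : V) (c : R) (u w : V) :
  LH3_metric q w (scal c u) = c * LH3_metric q w u.
Proof. rewrite !(LH3_metric_sym q w); apply LH3_metric_scal_l. Qed.

Lemma normal_part_plus (f : C -> V) (z : C) (u v : V) :
  normal_part LH3_metric f z (plus u v)
  = plus (normal_part LH3_metric f z u) (normal_part LH3_metric f z v).
Proof.
  unfold normal_part, sum_coord; rewrite !LH3_metric_plus_l.
  apply V_ext; rewrite ?fst_minus, ?fst_plus, ?fst_scal, ?Cconj_snd_minus, ?Cconj_snd_plus,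
    ?fst_minus, ?Cconj_snd_minus, ?fst_plus, ?fst_scal, ?Cconj_snd_plus,
    ?Cconj_snd_scal, ?RtoC_mult, ?RtoC_plus; ring.
Qed.

Lemma normal_part_scal (f : C -> V) (z : C) (c : R) (v : V) :
  normal_part LH3_metric f z (scal c v) = scal c (normal_part LH3_metric f z v).
Proof.
  unfold normal_part, sum_coord; rewrite !LH3_metric_scal_l.
  apply V_ext; rewrite ?fst_minus, ?fst_plus, ?fst_scal, ?Cconj_snd_minus, ?Cconj_snd_plus,
    ?Cconj_snd_scal, ?fst_minus, ?Cconj_snd_minus, ?fst_plus, ?fst_scal, ?Cconj_snd_plus,
    ?Cconj_snd_scal, ?RtoC_mult; ring.
Qed.

(* The Hermitian form g + i omega / 2 lives on a complex plane, so the Gram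
   determinant of any three vectors vanishes. *)
Lemma LH3_Gram (q v x y : V) :
  let g := LH3_metric q in
  let w u u' := LH3_symplectic q u u' / 2 in
  g v v * (g x x * g y y - g x y ^ 2 - w x y ^ 2)
  = g x x * (g v y ^ 2 + w v y ^ 2) + g y y * (g v x ^ 2 + w v x ^ 2)
    - 2 * (g x y * (g v x * g v y + w v x * w v y)
           + w x y * (g v x * w v y - w v x * g v y)).
Proof.
  cbv beta zeta; rewrite !LH3_metric_fiber, !LH3_symplectic_fiber.
  generalize (fiber_coord q v) (fiber_coord q x) (fiber_coord q y) (fst v) (fst x) (fst y).
  intros [a1 a2] [b1 b2] [c1 c2] [d1 d2] [e1 e2] [f1 f2]; simpl. field.
Qed.

(** The Gram identity with Omega(X, Y) = 0 trades the products g(v, .) for Omega(v, .), so no basis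
    of the normal plane is required. The 4 comes from halving Omega. *)
Lemma normal_part_norm (f : C -> V) (z : C) (v : V) :
  let X := tangent f cx z in
  let Y := tangent f cy z in
  LH3_symplectic (f z) X Y = 0 ->
  induced_det LH3_metric f z <> 0 ->
  LH3_metric (f z) (normal_part LH3_metric f z v) (normal_part LH3_metric f z v)
    * induced_det LH3_metric f z
  = (induced_metric LH3_metric f z cx cx * LH3_symplectic (f z) v Y ^ 2
     - 2 * induced_metric LH3_metric f z cx cy
         * (LH3_symplectic (f z) v X * LH3_symplectic (f z) v Y)
     + induced_metric LH3_metric f z cy cy * LH3_symplectic (f z) v X ^ 2) / 4.
Proof.
  intros X Y lag nz.
  assert (G := LH3_Gram (f z) v X Y); cbv beta zeta in G; rewrite lag in G.
  unfold normal_part, sum_coord, induced_cometric.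
  fold X Y; rewrite minus_scal_opp_one.
  repeat first [rewrite LH3_metric_plus_l | rewrite LH3_metric_plus_r
    | rewrite LH3_metric_scal_l | rewrite LH3_metric_scal_r].
  unfold induced_det, induced_metric in *; fold X Y; fold X Y in nz.
  rewrite (LH3_metric_sym (f z) Y X) in *.
  rewrite (LH3_metric_sym (f z) X v), (LH3_metric_sym (f z) Y v).
  set (gxx := LH3_metric (f z) X X) in *; set (gxy := LH3_metric (f z) X Y) in *;
  set (gyy := LH3_metric (f z) Y Y) in *; set (gvv := LH3_metric (f z) v v) in *;
  set (gvx := LH3_metric (f z) v X) in *; set (gvy := LH3_metric (f z) v Y) in *;
  set (wx := LH3_symplectic (f z) v X) in *; set (wy := LH3_symplectic (f z) v Y) in *.
  (* The left side is the Gram determinant of v, X, Y; the summand [(0 / 2) ^ 2] keeps the shape in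
     which [G] rewrites. *)
  transitivity (gvv * (gxx * gyy - gxy ^ 2 - (0 / 2) ^ 2)
                - (gxx * gvy ^ 2 + gyy * gvx ^ 2 - 2 * gxy * gvx * gvy)).
  - field; exact nz.
  - rewrite G; field.
Qed.

(** The projection is linear, so the trace may be taken first and a single vector projected. *)
Lemma mean_curvature_normal_part (Gam : V -> V -> V -> V) (f : C -> V) (z : C) :
  mean_curvature LH3_metric Gam f z =
  normal_part LH3_metric f z
    (sum_coord (fun a => sum_coord (fun b =>
       scal (induced_cometric LH3_metric f z a b)
         (plus (tangent (tangent f b) a z) (Gam (f z) (tangent f a z) (tangent f b z)))))).
Proof.
  unfold mean_curvature, second_fundamental_form, sum_coord.
  rewrite !normal_part_plus, !normal_part_scal, !normal_part_plus; reflexivity.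
Qed.

(* Here [bx], [b_y] are the partials of conj(mu_2) divided by A^2 and [bxy] is the
   y-derivative of [bx]; the four terms of [tr] are Omega of the covariant second
   derivatives of the graph, weighted by the inverse metric. *)
Lemma trace_formula (bx b_y bxx bxy byx byy F : C) (hx hy px py : R) :
  let s := ((bx - Ci * b_y) / 2)%C in
  let gxx := 2 * Im bx in
  let gxy := Im (Ci * bx + b_y)%C in
  let gyy := 2 * Im (Ci * b_y)%C in
  let det := gxx * gyy - gxy * gxy in
  let om (a d e b : C) := - 2 * Re (a * b - e * d)%C in
  let tr (e b : C) :=
    gyy / det * om (- (2) * F)%C (bxx + 2 * F * bx)%C e b
    + - gxy / det * om (- (2) * F * Ci)%C (byx + 2 * F * b_y)%C e b
    + (- gxy / det * om (- (2) * F * Ci)%C (bxy + 2 * Ci * F * bx)%C e b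
       + gxx / det * om (2 * F)%C (byy + 2 * Ci * F * b_y)%C e b) in
  Im bx + Re b_y = 0 -> Im bxx + Re byx = 0 -> Im bxy + Re byy = 0 ->
  F = ((hx - Ci * hy) / 2)%C ->
  (bxy + 2 * Ci * F * bx = byx + 2 * F * b_y)%C ->
  2 * px * (Re s ^ 2 + Im s ^ 2) = Im ((bxx - Ci * byx) / 2 * Cconj s)%C ->
  2 * py * (Re s ^ 2 + Im s ^ 2) = Im ((bxy - Ci * byy) / 2 * Cconj s)%C ->
  det <> 0 ->
  tr 1%C bx = 4 * (hy - px) /\ tr Ci b_y = - 4 * (hx + py).
Proof.
  destruct bx as [x1 x2], b_y as [y1 y2], bxx as [p1 p2], byx as [q1 q2],
    bxy as [r1 r2], byy as [t1 t2].
  intros s gxx gxy gyy det om tr e1 e2 e3 -> e4 e5 e6 nz.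
  simpl in e1, e2, e3.
  (* The Lagrangian identity and its two derivatives eliminate one real unknown each; the symmetry
     [e4] then eliminates [r1] and [r2]. *)
  assert (y1 = - x2) by lra; assert (q1 = - p2) by lra; assert (t1 = - r2) by lra; subst.
  injection e4 as e41 e42; simpl in e41, e42.
  assert (r1 = - p2 + hy * (y2 - x1)) by lra.
  assert (r2 = q2 + hx * (y2 - x1)) by lra. subst.
  (* This is -4 |s|^2, so non-degeneracy permits solving [e5] and [e6] for [px] and [py]. *)
  assert (D : det = - (4 * x2 ^ 2 + (x1 + y2) ^ 2)) by (unfold det, gxx, gxy, gyy; simpl; ring).
  rewrite D in nz.
  assert (nz' : 4 * x2 ^ 2 + (x1 + y2) ^ 2 <> 0) by lra.
  assert (px = 2 * (p2 * ((x1 + y2) / 2) - (p1 + q2) / 2 * x2) / (4 * x2 ^ 2 + (x1 + y2) ^ 2)).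
  { apply (Rmult_eq_reg_r ((4 * x2 ^ 2 + (x1 + y2) ^ 2) / 2)); [| lra].
    transitivity (2 * px * (Re s ^ 2 + Im s ^ 2)); [unfold s; simpl; field |].
    rewrite e5; unfold s; simpl; field; lra. }
  assert (py = 2 * ((q2 + hx * (y2 - x1)) * ((x1 + y2) / 2)
                    - (- p2 + hy * (y2 - x1) + t2) / 2 * x2) / (4 * x2 ^ 2 + (x1 + y2) ^ 2)).
  { apply (Rmult_eq_reg_r ((4 * x2 ^ 2 + (x1 + y2) ^ 2) / 2)); [| lra].
    transitivity (2 * py * (Re s ^ 2 + Im s ^ 2)); [unfold s; simpl; field |].
    rewrite e6; unfold s; simpl; field; lra. }
  subst px py.
  split; unfold tr; rewrite D; unfold om, gxx, gxy, gyy; simpl; field; simpl in nz'; nra.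
Qed.

(** * Second derivatives of a Lagrangian graph *)

(** The product of two inverses, rather than the inverse of a square, is what the product rule and
    [has_partial_inv] differentiate directly. *)
Definition graph_fiber (f : C -> C) (a : coord) (z : C) : C :=
  (Cconj (partial a f z) * (/ (1 + z * Cconj (f z)) * / (1 + z * Cconj (f z))))%C.

Lemma fiber_coord_tangent (f : C -> C) (a : coord) (z : C) :
  fiber_coord (graph f z) (tangent (graph f) a z) = graph_fiber f a z.
Proof.
  rewrite tangent_graph; unfold fiber_coord, graph_fiber, Cdiv; rewrite Cinv_sqr; reflexivity.
Qed.

Definition graph_fiber_partial (f : C -> C) (c a : coord) (z : C) : C :=
  (Cconj (partial c (partial a f) z) / (1 + z * Cconj (f z)) ^ 2
   - 2 * Cconj (partial a f z) * (coord_dir c * Cconj (f z) + z * Cconj (partial c f z))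
     / (1 + z * Cconj (f z)) ^ 3)%C.

Lemma has_partial_graph_fiber (U : C -> Prop) (f : C -> C) (c a : coord) (z : C) :
  smooth U f -> U z -> LH3 (graph f z) ->
  has_partial c (graph_fiber f a) z (graph_fiber_partial f c a z).
Proof.
  intros sf Uz nz; assert (A0 : (1 + z * Cconj (f z))%C <> 0) by exact nz.
  assert (df := has_partial_conj _ _ _ _ (smooth_has_partial c _ _ _ sf Uz)).
  assert (dA := has_partial_plus _ _ _ _ _ _ (has_partial_const c 1 z)
                  (has_partial_mult _ _ _ _ _ _ (has_partial_id c z) df)).
  assert (dI := has_partial_inv _ (fun w => 1 + w * Cconj (f w))%C _ _ A0 dA).
  assert (d := has_partial_mult _ _ _ _ _ _
                 (has_partial_conj _ _ _ _
                    (smooth_has_partial c _ _ _ (smooth_partial a _ _ sf) Uz))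
                 (has_partial_mult _ _ _ _ _ _ dI dI)).
  eapply (eq_ind _ (has_partial _ _ _)); [exact d |].
  unfold graph_fiber_partial; field; exact A0.
Qed.

Definition covariant_acceleration (f : C -> C) (c a : coord) (z : C) : V :=
  plus (tangent (tangent (graph f) a) c z)
    (LH3_connection (graph f z) (tangent (graph f) c z) (tangent (graph f) a z)).

Lemma fst_covariant_acceleration (f : C -> C) (c a : coord) (z : C) :
  fst (covariant_acceleration f c a z)
  = (- (2) * graph_F f z * (coord_dir c * coord_dir a))%C.
Proof.
  unfold covariant_acceleration; rewrite fst_plus, tangent_tangent_graph, !tangent_graph.
  unfold LH3_connection, graph_F, graph, Cdiv; cbn [fst snd]; ring.
Qed.

(** The Christoffel term -2a/A accounts for the part of the derivative of A^-2 due to b; the part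
    due to a is compensated by the term in [graph_F]. *)
Lemma fiber_covariant_acceleration (f : C -> C) (c a : coord) (z : C) :
  LH3 (graph f z) ->
  fiber_coord (graph f z) (covariant_acceleration f c a z)
  = (graph_fiber_partial f c a z + 2 * coord_dir c * graph_F f z * graph_fiber f a z)%C.
Proof.
  intros nz; assert (A0 : (1 + z * Cconj (f z))%C <> 0) by exact nz.
  unfold covariant_acceleration; rewrite fiber_coord_plus, tangent_tangent_graph, !tangent_graph.
  unfold fiber_coord, LH3_connection, graph_fiber_partial, graph_fiber, graph_F, graph;
    cbn [fst snd]; rewrite Cconj_conj.
  field; exact A0.
Qed.

(** Both sides are fibre coordinates of covariant second derivatives with exchanged indices; they
    agree because the mixed partials of mu_2 do. *)
Lemma graph_fiber_Schwarz (U : C -> Prop) (f : C -> C) (z : C) :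
  open U -> smooth U f -> U z -> LH3 (graph f z) ->
  (graph_fiber_partial f cy cx z + 2 * Ci * graph_F f z * graph_fiber f cx z
   = graph_fiber_partial f cx cy z + 2 * graph_F f z * graph_fiber f cy z)%C.
Proof.
  intros oU sf Uz nz; assert (A0 : (1 + z * Cconj (f z))%C <> 0) by exact nz.
  unfold graph_fiber_partial, graph_fiber, graph_F.
  rewrite (partial_comm _ _ _ oU sf Uz); cbn [coord_dir]; field; exact A0.
Qed.

Lemma graph_sigma0_fiber (f : C -> C) (z : C) :
  graph_sigma0 f z = ((graph_fiber f cx z - Ci * graph_fiber f cy z) / 2)%C.
Proof.
  unfold graph_sigma0, del, graph_fiber, Cdiv.
  rewrite <- !Cconj_partial, Cinv_sqr; ring.
Qed.

Lemma LH3_symplectic_graph (f : C -> C) (z : C) (v : V) (a : coord) :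
  LH3_symplectic (graph f z) v (tangent (graph f) a z)
  = - 2 * Re (fst v * graph_fiber f a z - coord_dir a * fiber_coord (graph f z) v)%C.
Proof.
  rewrite LH3_symplectic_fiber, fiber_coord_tangent, tangent_graph; reflexivity.
Qed.

Lemma induced_metric_graph (f : C -> C) (z : C) (a b : coord) :
  induced_metric LH3_metric (graph f) z a b
  = Im (coord_dir a * graph_fiber f b z + coord_dir b * graph_fiber f a z)%C.
Proof.
  unfold induced_metric; rewrite LH3_metric_fiber, !fiber_coord_tangent, !tangent_graph.
  reflexivity.
Qed.

Lemma lagrangian_graph_fiber (U : C -> Prop) (f : C -> C) (z : C) :
  lagrangian LH3_symplectic U (graph f) -> U z ->
  Im (graph_fiber f cx z) + Re (graph_fiber f cy z) = 0.
Proof.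
  intros lag Uz; assert (e := lag z Uz cx cy).
  rewrite LH3_symplectic_graph, fiber_coord_tangent, tangent_graph in e.
  revert e; generalize (graph_fiber f cx z) (graph_fiber f cy z); intros [a b] [c d]; simpl.
  intros e; lra.
Qed.

(** The Lagrangian identity holds on the whole open set and may be differentiated; this supplies the
    remaining symmetry of the cubic form. *)
Lemma lagrangian_graph_fiber_partial (U : C -> Prop) (f : C -> C) (c : coord) (z : C) :
  open U -> smooth U f -> (forall w, U w -> LH3 (graph f w)) ->
  lagrangian LH3_symplectic U (graph f) -> U z ->
  Im (graph_fiber_partial f c cx z) + Re (graph_fiber_partial f c cy z) = 0.
Proof.
  intros oU sf nz lag Uz.
  destruct (has_partial_graph_fiber _ f c cx _ sf Uz (nz z Uz)) as [_ di].
  destruct (has_partial_graph_fiber _ f c cy _ sf Uz (nz z Uz)) as [dr _].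
  assert (d := is_derive_plus _ _ _ _ _ di dr).
  transitivity (Derive (fun _ => 0) (coord_val c z)); [symmetry | apply Derive_const].
  apply is_derive_unique.
  eapply is_derive_ext_loc; [| exact d].
  apply (filter_imp (fun t => U (coord_line c z t)));
    [| apply (coord_line_locally c U z oU Uz)].
  intros t Ht; exact (lagrangian_graph_fiber U f _ lag Ht).
Qed.

(** * Derivatives of the Lagrangian angle *)

Definition real_partial (a : coord) (f : C -> R) (z : C) : R :=
  Derive (fun t => f (coord_line a z t)) (coord_val a z).

Lemma smooth_real_is_derive (U : C -> Prop) (f : C -> R) (a : coord) (z : C) :
  smooth_real U f -> U z ->
  is_derive (fun t => f (coord_line a z t)) (coord_val a z) (real_partial a f z).
Proof.
  intros sf Uz; destruct (sf 1%nat z Uz) as (_ & fx & fy & _).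
  destruct a; apply Derive_correct; assumption.
Qed.

Lemma Cexp_2i (p : R) : Cexp (2 * Ci * p)%C = (cos (2 * p), sin (2 * p)).
Proof.
  unfold Cexp; simpl.
  replace (_ - _) with 0 at 1 2 by ring; rewrite exp_0.
  f_equal; rewrite Rmult_1_l; f_equal; ring.
Qed.

(** The function differentiated is Im ((u + iv) e^(-2ip)). *)
Lemma is_derive_phase (u v p : R -> R) (t u' v' p' : R) :
  is_derive u t u' -> is_derive v t v' -> is_derive p t p' ->
  is_derive (fun s => v s * cos (2 * p s) - u s * sin (2 * p s)) t
    (v' * cos (2 * p t) - u' * sin (2 * p t)
     - 2 * p' * (v t * sin (2 * p t) + u t * cos (2 * p t))).
Proof.
  intros du dv dp; auto_derive.
  - repeat split; eexists; eassumption.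
  - rewrite (is_derive_unique (fun x : R => u x) _ _ du), (is_derive_unique (fun x : R => v x) _ _ dv),
      (is_derive_unique (fun x : R => p x) _ _ dp); ring.
Qed.

(** By definition of the angle, Im (sigma_0 e^(-2i phi)) vanishes on [U]. Differentiating this and
    multiplying by |sigma_0| gives the formula without ever differentiating the modulus. *)
Lemma lagrangian_angle_partial (U : C -> Prop) (f : C -> C) (phi : C -> R) (c : coord) (z : C) :
  open U -> smooth U f -> (forall w, U w -> LH3 (graph f w)) ->
  lagrangian_angle U f phi -> U z ->
  let s := graph_sigma0 f z in
  2 * real_partial c phi z * (Re s ^ 2 + Im s ^ 2)
  = Im ((graph_fiber_partial f c cx z - Ci * graph_fiber_partial f c cy z) / 2 * Cconj s)%C.
Proof.
  intros oU sf nz [sphi angle] Uz s.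
  assert (ds : has_partial c (graph_sigma0 f) z
    (((graph_fiber_partial f c cx z - Ci * graph_fiber_partial f c cy z) / 2)%C)).
  { assert (dx := has_partial_graph_fiber _ f c cx _ sf Uz (nz z Uz)).
    assert (dy := has_partial_graph_fiber _ f c cy _ sf Uz (nz z Uz)).
    assert (d := has_partial_mult _ _ _ _ _ _ (has_partial_plus _ _ _ _ _ _ dx
      (has_partial_mult _ _ _ _ _ _ (has_partial_const c (- Ci)%C z) dy))
      (has_partial_const c (/ 2)%C z)).
    eapply has_partial_ext; [exact oU | exact Uz | |
      eapply (eq_ind _ (has_partial _ _ _)); [exact d |]].
    - intros w _; rewrite graph_sigma0_fiber; unfold Cdiv; ring.
    - unfold Cdiv; ring. }
  destruct ds as [dr di].
  assert (d := is_derive_phase _ _ _ _ _ _ _ dr di (smooth_real_is_derive _ _ c _ sphi Uz)).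
  cbv beta in d; rewrite coord_line_val in d.
  assert (dz : is_derive (fun _ : R => 0) (coord_val c z)
    (Im ((graph_fiber_partial f c cx z - Ci * graph_fiber_partial f c cy z) / 2)%C
       * cos (2 * phi z)
     - Re ((graph_fiber_partial f c cx z - Ci * graph_fiber_partial f c cy z) / 2)%C
       * sin (2 * phi z)
     - 2 * real_partial c phi z * (Im s * sin (2 * phi z) + Re s * cos (2 * phi z)))).
  { eapply is_derive_ext_loc; [| exact d].
    apply (filter_imp (fun t => U (coord_line c z t)));
      [| apply (coord_line_locally c U z oU Uz)].
    intros t Ht; rewrite (angle _ Ht), Cexp_2i; simpl; ring. }
  apply is_derive_unique in dz; rewrite Derive_const in dz.
  assert (es := angle z Uz); fold s in es; rewrite Cexp_2i in es.
  assert (s1 : Re s = Cmod s * cos (2 * phi z)) by (rewrite es at 1; simpl; ring).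
  assert (s2 : Im s = Cmod s * sin (2 * phi z)) by (rewrite es at 1; simpl; ring).
  revert dz; generalize (((graph_fiber_partial f c cx z
    - Ci * graph_fiber_partial f c cy z) / 2)%C) (real_partial c phi z).
  intros s' p dz.
  (* The bracket is Re (s e^(-2i phi)), the coefficient of the angle's derivative in [dz]. *)
  assert (cs : Re s ^ 2 + Im s ^ 2
               = Cmod s * (Im s * sin (2 * phi z) + Re s * cos (2 * phi z)))
    by (rewrite s1, s2; ring).
  rewrite cs; transitivity (Im s' * Re s - Re s' * Im s);
    [| destruct s, s'; simpl; ring].
  rewrite s1 at 2; rewrite s2 at 2.
  transitivity (Cmod s * (Im s' * cos (2 * phi z) - Re s' * sin (2 * phi z))); [| ring].
  transitivity (Cmod s * (2 * p * (Im s * sin (2 * phi z) + Re s * cos (2 * phi z)))); [ring |].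
  f_equal; lra.
Qed.

(** * The mean curvature of a Lagrangian graph *)

(** The mean curvature vector before normal projection; on a Lagrangian surface both have the same
    Omega-pairing with tangent vectors. *)
Definition mean_acceleration (f : C -> C) (z : C) : V :=
  sum_coord (fun a => sum_coord (fun b =>
    scal (induced_cometric LH3_metric (graph f) z a b) (covariant_acceleration f a b z))).

Lemma potential_graph_F (U : C -> Prop) (f : C -> C) (h : C -> R) (z : C) :
  potential U f h -> U z ->
  graph_F f z = ((real_partial cx h z - Ci * real_partial cy h z) / 2)%C.
Proof.
  intros [_ F] Uz; rewrite (F z Uz); unfold del, real_partial; simpl.
  unfold RtoC; simpl; rewrite !Derive_const; reflexivity.
Qed.

(** [trace_formula] applied to the graph. The values are the components of the 1-form -4 (d phi +
    star dh), where star is the flat Hodge star with star dx = dy. *)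
Lemma symplectic_mean_acceleration (U : C -> Prop) (f : C -> C) (h phi : C -> R) (z : C) :
  open U -> smooth U f -> (forall w, U w -> LH3 (graph f w)) ->
  lagrangian LH3_symplectic U (graph f) ->
  potential U f h -> lagrangian_angle U f phi -> U z ->
  induced_det LH3_metric (graph f) z <> 0 ->
  LH3_symplectic (graph f z) (mean_acceleration f z) (tangent (graph f) cx z)
    = 4 * (real_partial cy h z - real_partial cx phi z) /\
  LH3_symplectic (graph f z) (mean_acceleration f z) (tangent (graph f) cy z)
    = - 4 * (real_partial cx h z + real_partial cy phi z).
Proof.
  intros oU sf nz lag pot ang Uz nd.
  assert (T := trace_formula (graph_fiber f cx z) (graph_fiber f cy z)
    (graph_fiber_partial f cx cx z) (graph_fiber_partial f cy cx z)
    (graph_fiber_partial f cx cy z) (graph_fiber_partial f cy cy z) (graph_F f z)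
    (real_partial cx h z) (real_partial cy h z)
    (real_partial cx phi z) (real_partial cy phi z)).
  cbv beta zeta in T.
  assert (gxx : induced_metric LH3_metric (graph f) z cx cx = 2 * Im (graph_fiber f cx z))
    by (rewrite induced_metric_graph; simpl; ring).
  assert (gyy : induced_metric LH3_metric (graph f) z cy cy = 2 * Im (Ci * graph_fiber f cy z)%C)
    by (rewrite induced_metric_graph; simpl; ring).
  assert (gxy : induced_metric LH3_metric (graph f) z cx cy
                = Im (Ci * graph_fiber f cx z + graph_fiber f cy z)%C)
    by (rewrite induced_metric_graph; simpl; ring).
  assert (gyx : induced_metric LH3_metric (graph f) z cy cx
                = Im (Ci * graph_fiber f cx z + graph_fiber f cy z)%C)
    by (rewrite induced_metric_graph; simpl; ring).
  rewrite <- gxx, <- gyy in T; rewrite <- gxy in T.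
  rewrite <- graph_sigma0_fiber in T.
  destruct T as [TX TY].
  - exact (lagrangian_graph_fiber U f z lag Uz).
  - exact (lagrangian_graph_fiber_partial U f cx z oU sf nz lag Uz).
  - exact (lagrangian_graph_fiber_partial U f cy z oU sf nz lag Uz).
  - exact (potential_graph_F U f h z pot Uz).
  - exact (graph_fiber_Schwarz U f z oU sf Uz (nz z Uz)).
  - exact (lagrangian_angle_partial U f phi cx z oU sf nz ang Uz).
  - exact (lagrangian_angle_partial U f phi cy z oU sf nz ang Uz).
  - unfold induced_det in nd; rewrite gyx, <- gxy in nd; exact nd.
  - unfold mean_acceleration, sum_coord, induced_cometric.
    split; [rewrite <- TX | rewrite <- TY];
      rewrite !LH3_symplectic_plus_l, !LH3_symplectic_scal_l, !LH3_symplectic_graph,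
        !fst_covariant_acceleration, !(fiber_covariant_acceleration _ _ _ _ (nz z Uz));
      unfold induced_det; rewrite gyx, <- gxy; cbn [coord_dir];
      rewrite !Cmult_1_r, !Cmult_1_l;
      replace (- (2) * graph_F f z * (Ci * Ci))%C with (2 * graph_F f z)%C
        by (apply injective_projections; simpl; ring);
      reflexivity.
Qed.

(** Uniqueness replaces whichever connection [marginally_trapped] supplies by the explicit one. *)
Lemma mean_curvature_connection (Gam : V -> V -> V -> V) (f : C -> C) (z : C) :
  LH3 (graph f z) -> levi_civita LH3 LH3_metric Gam ->
  mean_curvature LH3_metric Gam (graph f) z
  = normal_part LH3_metric (graph f) z (mean_acceleration f z).
Proof.
  intros nz LC; rewrite mean_curvature_normal_part.
  assert (e : forall u v, Gam (graph f z) u v = LH3_connection (graph f z) u v).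
  { intros u v; apply (levi_civita_unique LH3 LH3_metric).
    - exact nz.
    - apply LH3_metric_sym.
    - intros v1 v2; apply LH3_metric_faithful, nz.
    - exact LC.
    - exact LH3_levi_civita. }
  unfold sum_coord; rewrite !e; reflexivity.
Qed.

(** * The function e^(-i phi - h) and the squared mean curvature *)

Lemma is_cderive_Cexp (p k : R -> R) (t p' k' : R) :
  is_derive p t p' -> is_derive k t k' ->
  is_cderive (fun s => Cexp (- Ci * p s - k s)%C) t
    ((- Ci * p' - k') * Cexp (- Ci * p t - k t))%C.
Proof.
  intros dp dk.
  assert (ex : forall s, Cexp (- Ci * p s - k s)%C
                         = (exp (- k s) * cos (p s), - (exp (- k s) * sin (p s)))).
  { intros s; unfold Cexp; simpl.
    replace (- (0) * p s - - (1) * 0 + - k s) with (- k s) by ring.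
    replace (- (0) * 0 + - (1) * p s + - 0) with (- p s) by ring.
    rewrite cos_neg, sin_neg; f_equal; ring. }
  rewrite ex; split.
  - eapply is_derive_ext; [intros s; rewrite ex; reflexivity |]; simpl.
    auto_derive; [repeat split; eexists; eassumption |].
    rewrite (is_derive_unique (fun x : R => p x) _ _ dp),
      (is_derive_unique (fun x : R => k x) _ _ dk); ring.
  - eapply is_derive_ext; [intros s; rewrite ex; reflexivity |]; simpl.
    auto_derive; [repeat split; eexists; eassumption |].
    rewrite (is_derive_unique (fun x : R => p x) _ _ dp),
      (is_derive_unique (fun x : R => k x) _ _ dk); ring.
Qed.

(** Here P + iQ = 2 (del h + i del phi), and the pair is (P + iQ) e^(-i phi). Omega(H, .) has
    components -4Q and -4P. With +h in the exponent the combination would be del h - i del phi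
    instead. *)
Lemma del_Cexp (U : C -> Prop) (h phi : C -> R) (z : C) :
  smooth_real U h -> smooth_real U phi -> U z ->
  let P := real_partial cx h z + real_partial cy phi z in
  let Q := real_partial cx phi z - real_partial cy h z in
  del (fun w : C => Cexp (- Ci * RtoC (phi w) - RtoC (h w))%C) z
  = (RtoC (- exp (- h z) / 2)
     * ((P * cos (phi z) + Q * sin (phi z))%R, (Q * cos (phi z) - P * sin (phi z))%R))%C.
Proof.
  intros sh sphi Uz P Q.
  assert (D : forall a, partial a (fun w : C => Cexp (- Ci * RtoC (phi w) - RtoC (h w))%C) z
    = ((- Ci * real_partial a phi z - real_partial a h z)
       * Cexp (- Ci * RtoC (phi z) - RtoC (h z)))%C).
  { intros a; apply has_partial_unique.
    assert (d := is_cderive_Cexp _ _ _ _ _ (smooth_real_is_derive _ _ a _ sphi Uz)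
                   (smooth_real_is_derive _ _ a _ sh Uz)).
    cbv beta in d; rewrite coord_line_val in d; exact d. }
  unfold del; rewrite !D.
  replace (Cexp (- Ci * phi z - h z)%C)
    with (exp (- h z) * cos (phi z), - (exp (- h z) * sin (phi z))).
  - unfold P, Q; apply injective_projections; simpl; field.
  - unfold Cexp; simpl.
    replace (- (0) * phi z - - (1) * 0 + - h z) with (- h z) by ring.
    replace (- (0) * 0 + - (1) * phi z + - 0) with (- phi z) by ring.
    rewrite cos_neg, sin_neg; f_equal; ring.
Qed.

(** Since gxx = -gyy = 2 |sigma_0| sin 2phi and gxy = 2 |sigma_0| cos 2phi, the quadratic form of
    [normal_part_norm] becomes -8 |sigma_0| Im ((P + iQ)^2 e^(-2i phi)), and X^2 carries the factor
    e^(-2h) / 4. The determinant stays on the left to avoid dividing. *)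
Lemma mean_curvature_norm (U : C -> Prop) (f : C -> C) (h phi : C -> R)
    (Gam : V -> V -> V -> V) (z : C) :
  open U -> smooth U f -> (forall w, U w -> LH3 (graph f w)) ->
  lagrangian LH3_symplectic U (graph f) ->
  potential U f h -> lagrangian_angle U f phi -> U z ->
  induced_det LH3_metric (graph f) z <> 0 ->
  levi_civita LH3 LH3_metric Gam ->
  let H := mean_curvature LH3_metric Gam (graph f) z in
  let X := del (fun w : C => Cexp (- Ci * RtoC (phi w) - RtoC (h w))%C) z in
  LH3_metric (graph f z) H H * induced_det LH3_metric (graph f) z * exp (- h z) ^ 2
  = - 64 * Cmod (graph_sigma0 f z) * (Re X * Im X).
Proof.
  intros oU sf nz lag pot ang Uz nd LC H X.
  unfold H; rewrite (mean_curvature_connection _ _ _ (nz z Uz) LC).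
  rewrite (normal_part_norm _ _ _ (lag z Uz cx cy) nd).
  destruct (symplectic_mean_acceleration U f h phi z oU sf nz lag pot ang Uz nd) as [-> ->].
  unfold X; rewrite (del_Cexp U h phi z (proj1 pot) (proj1 ang) Uz).
  assert (l := lagrangian_graph_fiber U f z lag Uz).
  assert (s := proj2 ang z Uz); rewrite Cexp_2i, graph_sigma0_fiber, cos_2a, sin_2a in s.
  rewrite !induced_metric_graph, graph_sigma0_fiber.
  revert s l; generalize (Cmod ((graph_fiber f cx z - Ci * graph_fiber f cy z) / 2)%C).
  generalize (graph_fiber f cx z) (graph_fiber f cy z); intros [x1 x2] [y1 y2] m s l.
  simpl in l; assert (y1 = - x2) by lra; subst y1.
  injection s as s1 s2; simpl in s1, s2.
  (* The double-angle form of sigma_0 expresses [x1] and [x2] through [cn] and [sn], leaving an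
     algebraic identity. *)
  generalize dependent (cos (phi z)); generalize (sin (phi z)); intros sn cn s1 s2.
  assert (e1 : x1 = 2 * m * (cn * cn - sn * sn) - y2) by lra.
  assert (e2 : x2 = 2 * m * sn * cn) by lra.
  rewrite e1, e2; simpl; field.
Qed.

Theorem theorem4 (U : C -> Prop) (mu2 : C -> C) (h phi : C -> R)
  (HU : open U)
  (Hsmooth : smooth U mu2)
  (HL : forall z : C, U z -> LH3 (graph mu2 z))
  (Hrank : forall z : C, U z -> surface_rank (graph mu2) z = 2%nat)
  (Hlag : lagrangian LH3_symplectic U (graph mu2))
  (Hnondeg : nondegenerate LH3_metric U (graph mu2))
  (Hh : potential U mu2 h)
  (Hphi : lagrangian_angle U mu2 phi) :
  marginally_trapped LH3 LH3_metric U (graph mu2) <->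
  (forall z : C, U z ->
     Im (del (fun w : C => Cexp (- Ci * RtoC (phi w) - RtoC (h w))%C) z) = 0 \/
     Re (del (fun w : C => Cexp (- Ci * RtoC (phi w) - RtoC (h w))%C) z) = 0).
Proof.
  assert (norm := fun z Uz Gam LC => mean_curvature_norm U mu2 h phi Gam z HU Hsmooth HL Hlag
    Hh Hphi Uz (Hnondeg z Uz) LC); cbv beta zeta in norm.
  split.
  - intros (Gam & LC & null) z Uz; specialize (norm z Uz Gam LC).
    rewrite (null z Uz), !Rmult_0_l in norm; symmetry in norm.
    apply Rmult_integral in norm; destruct norm as [s0 | X0].
    (* A zero of sigma_0, combined with the Lagrangian identity, makes the induced determinant
       vanish. *)
    + exfalso; apply (Hnondeg z Uz).
      assert (s : graph_sigma0 mu2 z = 0) by (apply Cmod_eq_0; lra).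
      rewrite graph_sigma0_fiber in s.
      assert (l := lagrangian_graph_fiber U mu2 z Hlag Uz).
      unfold induced_det; rewrite !induced_metric_graph; revert s l.
      generalize (graph_fiber mu2 cx z) (graph_fiber mu2 cy z); intros [x1 x2] [y1 y2] s l.
      injection s as s1 s2; simpl in *.
      assert (x2 = 0) by lra; assert (y1 = 0) by lra; assert (x1 = - y2) by lra; subst; ring.
    + apply Rmult_integral in X0; tauto.
  - intros X0; exists LH3_connection; split; [exact LH3_levi_civita |].
    intros z Uz; specialize (norm z Uz _ LH3_levi_civita).
    assert (X := X0 z Uz); revert norm X.
    generalize (del (fun w : C => Cexp (- Ci * RtoC (phi w) - RtoC (h w))%C) z); intros x norm X.
    assert (zero : Re x * Im x = 0) by (destruct X as [-> | ->]; ring).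
    rewrite zero, Rmult_0_r in norm.
    assert (e := exp_pos (- h z)).
    (* Both cofactors of the squared length, the determinant and e^(-2h), are nonzero. *)
    apply Rmult_integral in norm; destruct norm as [n | n]; [| nra].
    apply Rmult_integral in n; destruct n as [n | n]; [exact n |].
    elim (Hnondeg z Uz n).
Qed.
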